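(* Let $ABC$ be an acute triangle, let $\gamma_a,\gamma_b,\gamma_c$ be its associated triad of circles, with radii $\rho_a,\rho_b,\rho_c$ respectively. Let $\rho_i$ be the radius of the inner Apollonius circle of $\gamma_a,\gamma_b,\gamma_c$ (externally tangent to each of them) and let $\rho_o$ be the radius of the outer Apollonius circle of $\gamma_a,\gamma_b,\gamma_c$ (internally tangent to each of them, surrounding all three). Then $$3\rho_o=2(\rho_a+\rho_b+\rho_c)+3\rho_i.$$
   Context: Let $\triangle ABC$ be an acute triangle in the plane. Let $\omega_a$ be the semicircle with diameter $BC$ erected inwardly (on the same side of $BC$ as $A$); $\omega_b$ and $\omega_c$ are defined similarly on $CA$ and $AB$. The circle $\gamma_a$ is the circle inside $\triangle ABC$, tangent to sides $AB$ and $AC$, and externally tangent to the semicircle $\omega_a$. Circles $\gamma_b$ (tangent to $BC$ and $BA$, externally tangent to $\omega_b$) and $\gamma_c$ (tangent to $CA$ and $CB$, externally tangent to $\omega_c$) are defined similarly. These three circles are the triad of circles associated with $\triangle ABC$. The inner Apollonius circle of $\gamma_a,\gamma_b,\gamma_c$ is the circle externally tangent to all three (the three circles lie outside it). The outer Apollonius circle is the circle that contains all three circles and is internally tangent to all three (each of the three circles lies inside it and touches it). *)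

(* Defs.v *)
From Stdlib Require Import Reals.
Open Scope R_scope.

Definition point : Type := (R * R)%type.

Definition dist (P Q : point) : R := dist_euc (fst P) (snd P) (fst Q) (snd Q).

Definition midpoint (P Q : point) : point :=
  ((fst P + fst Q) / 2, (snd P + snd Q) / 2).

(* Inner product of the vectors QP and QS. *)
Definition dot (P Q S : point) : R :=
  (fst P - fst Q) * (fst S - fst Q) + (snd P - snd Q) * (snd S - snd Q).

(* Twice the signed area of PQS. *)
Definition orient (P Q S : point) : R :=
  (fst Q - fst P) * (snd S - snd P) - (snd Q - snd P) * (fst S - fst P).

(* The angle PQS, with vertex Q. *)
Definition angle (P Q S : point) : R := acos (dot P Q S / (dist P Q * dist S Q)).

Definition acute_triangle (A B C : point) : Prop :=
  orient A B C <> 0 /\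
  angle B A C < PI / 2 /\ angle C B A < PI / 2 /\ angle A C B < PI / 2.

Definition on_line (P Q X : point) : Prop :=
  exists t : R, X = ((1 - t) * fst P + t * fst Q, (1 - t) * snd P + t * snd Q).

Definition on_segment (P Q X : point) : Prop :=
  exists t : R, 0 <= t <= 1 /\
    X = ((1 - t) * fst P + t * fst Q, (1 - t) * snd P + t * snd Q).

Definition in_triangle (A B C X : point) : Prop :=
  exists u v w : R, 0 <= u /\ 0 <= v /\ 0 <= w /\ u + v + w = 1 /\
    X = (u * fst A + v * fst B + w * fst C, u * snd A + v * snd B + w * snd C).

(* A circle is given by its center O and its radius r; positivity of r is
   required separately wherever a circle is introduced. *)
Definition on_circle (O : point) (r : R) (X : point) : Prop := dist X O = r.

Definition in_disc (O : point) (r : R) (X : point) : Prop := dist X O <= r.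

(* The line PQ is tangent to the circle, and the point of contact belongs to
   the side PQ. *)
Definition tangent_to_side (O : point) (r : R) (P Q : point) : Prop :=
  exists T : point, on_segment P Q T /\
    forall X : point, (on_line P Q X /\ on_circle O r X) <-> X = T.

(* The two circles touch at T and each lies outside the other. *)
Definition externally_tangent_at (O1 : point) (r1 : R) (O2 : point) (r2 : R)
    (T : point) : Prop :=
  forall X : point, (in_disc O1 r1 X /\ in_disc O2 r2 X) <-> X = T.

Definition externally_tangent (O1 : point) (r1 : R) (O2 : point) (r2 : R) : Prop :=
  exists T : point, externally_tangent_at O1 r1 O2 r2 T.

(* The first circle lies inside the second one and touches it at one point. *)
Definition internally_tangent (O1 : point) (r1 : R) (O2 : point) (r2 : R) : Prop :=
  (forall X : point, in_disc O1 r1 X -> in_disc O2 r2 X) /\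
  exists T : point,
    forall X : point, (on_circle O1 r1 X /\ on_circle O2 r2 X) <-> X = T.

(* The semicircle with diameter BC erected on the side of BC containing A. *)
Definition on_semicircle (A B C X : point) : Prop :=
  on_circle (midpoint B C) (dist B C / 2) X /\ 0 <= orient B C X * orient B C A.

(* The circle of the triad associated with the vertex A; the roles of B and C
   are interchangeable. *)
Definition triad_circle (A B C O : point) (r : R) : Prop :=
  0 < r /\
  (forall X : point, in_disc O r X -> in_triangle A B C X) /\
  tangent_to_side O r A B /\ tangent_to_side O r A C /\
  exists T : point, on_semicircle A B C T /\
    externally_tangent_at O r (midpoint B C) (dist B C / 2) T.

Definition inner_apollonius (O1 : point) (r1 : R) (O2 : point) (r2 : R)
    (O3 : point) (r3 : R) (O : point) (r : R) : Prop :=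
  0 < r /\ externally_tangent O1 r1 O r /\ externally_tangent O2 r2 O r /\
  externally_tangent O3 r3 O r.

Definition outer_apollonius (O1 : point) (r1 : R) (O2 : point) (r2 : R)
    (O3 : point) (r3 : R) (O : point) (r : R) : Prop :=
  0 < r /\ internally_tangent O1 r1 O r /\ internally_tangent O2 r2 O r /\
  internally_tangent O3 r3 O r.

(* Main.v *)
(** Let I and r be the incenter and the inradius. The tangency to [AB] and [AC]
    puts the center of [gamma_a] at [I + t (A - I)] with radius [r (1 - t)], and the
    tangency to the semicircle is a quadratic equation for [t] whose only
    nonnegative root is [t = tan (A / 2)]. Regard a circle with center
    [(p, q)] and radius [rho] as the point [(p, q, rho)] of Minkowski space with the
    form [p^2 + q^2 - rho^2]. Any two circles of the triad then have squared
    distance [4 r^2], so they are the vertices of an equilateral triangle in a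
    spacelike plane. The outer Apollonius circle [(Oo, rho_o)] and the inner one,
    taken as [(Oi, - rho_i)], are the two points at null distance from all three
    vertices. They lie on the normal of that plane through the centroid, symmetrically,
    so the centroid is their midpoint; the third coordinate gives the
    formula. *)

From Stdlib Require Import Reals Lra Psatz.
Require Import Defs.
Open Scope R_scope.

(** * Distances and tangent circles *)

Lemma dist_nonneg (P Q : point) : 0 <= dist P Q.
Proof. apply sqrt_pos. Qed.

Lemma dist_sqr (P Q : point) :
  dist P Q ^ 2 = (fst P - fst Q) ^ 2 + (snd P - snd Q) ^ 2.
Proof.
  unfold dist, dist_euc. rewrite pow2_sqrt; [unfold Rsqr; ring |].
  apply Rplus_le_le_0_compat; apply Rle_0_sqr.
Qed.

Lemma dist_eq (P Q : point) (d : R) :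
  0 <= d -> (fst P - fst Q) ^ 2 + (snd P - snd Q) ^ 2 = d ^ 2 -> dist P Q = d.
Proof.
  intros Hd H. rewrite <- dist_sqr in H.
  apply Rsqr_inj; [apply dist_nonneg | easy | unfold Rsqr; nra].
Qed.

Lemma dist_triangle (P Q S : point) : dist P Q <= dist P S + dist S Q.
Proof. apply triangle. Qed.

Lemma dist_sym (P Q : point) : dist P Q = dist Q P.
Proof. apply distance_symm. Qed.

(** If the centers were closer than [r1 + r2], the point [X] dividing [O1 O2] in the ratio [r1 : r2]
    would be interior to both discs, and a small shift [Y] of it would be a second common point. *)
Lemma externally_tangent_dist (O1 O2 : point) (r1 r2 : R) :
  0 < r1 -> 0 < r2 -> externally_tangent O1 r1 O2 r2 -> dist O1 O2 = r1 + r2.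
Proof.
  intros H1 H2 [T HT]. unfold externally_tangent_at, in_disc in HT.
  destruct (proj2 (HT T) eq_refl) as [HT1 HT2].
  pose proof (dist_triangle O1 O2 T) as Htri. rewrite (dist_sym O1 T) in Htri.
  destruct (Rle_lt_or_eq_dec (dist O1 O2) (r1 + r2)) as [Hlt | Heq]; [lra | | easy].
  exfalso.
  pose proof (dist_nonneg O1 O2) as Hd0.
  set (d := dist O1 O2) in *.
  set (k := d / (r1 + r2)).
  assert (Hk : d = k * (r1 + r2)) by (unfold k; field; lra).
  assert (Hk1 : 0 <= k < 1) by nra.
  set (eps := (1 - k) * Rmin r1 r2).
  assert (Heps : 0 < eps)
    by (unfold eps; pose proof (Rmin_pos r1 r2 H1 H2); nra).
  assert (He1 : eps <= (1 - k) * r1)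
    by (unfold eps; pose proof (Rmin_l r1 r2); nra).
  assert (He2 : eps <= (1 - k) * r2)
    by (unfold eps; pose proof (Rmin_r r1 r2); nra).
  set (l := r1 / (r1 + r2)).
  set (X := ((1 - l) * fst O1 + l * fst O2, (1 - l) * snd O1 + l * snd O2)).
  set (Y := (fst X + eps, snd X)).
  pose proof (dist_sqr O1 O2) as Hsq. fold d in Hsq.
  assert (HX1 : dist X O1 = k * r1).
  { apply dist_eq; [nra |].
    transitivity (l ^ 2 * d ^ 2); [rewrite Hsq; unfold X; simpl; ring |].
    rewrite Hk; unfold l; field; lra. }
  assert (HX2 : dist X O2 = k * r2).
  { apply dist_eq; [nra |].
    transitivity ((1 - l) ^ 2 * d ^ 2); [rewrite Hsq; unfold X; simpl; ring |].
    rewrite Hk; unfold l; field; lra. }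
  assert (HYX : dist Y X = eps).
  { apply dist_eq; [lra | unfold Y; simpl; ring]. }
  assert (EX : X = T) by (apply HT; split; nra).
  assert (EY : Y = T).
  { apply HT. pose proof (dist_triangle Y O1 X). pose proof (dist_triangle Y O2 X).
    split; lra. }
  assert (HYX' : fst Y = fst X) by congruence.
  unfold Y in HYX'; simpl in HYX'; lra.
Qed.

(** The contact point gives [r2 <= dist O1 O2 + r1]. Conversely, the point of the first disc
    farthest from [O2] is at distance [dist O1 O2 + r1] and lies in the second disc; for equal
    centers any point of the first circle serves. *)
Lemma internally_tangent_dist (O1 O2 : point) (r1 r2 : R) :
  0 < r1 -> internally_tangent O1 r1 O2 r2 -> dist O1 O2 = r2 - r1.
Proof.
  intros H1 [Hin [T HT]]. unfold on_circle, in_disc in *.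
  destruct (proj2 (HT T) eq_refl) as [HT1 HT2].
  pose proof (dist_triangle T O2 O1) as Htri.
  enough (dist O1 O2 + r1 <= r2) by lra.
  pose proof (dist_sqr O1 O2) as Hsq.
  destruct (Rle_lt_or_eq_dec 0 (dist O1 O2)) as [Hd | Hd]; [apply dist_nonneg | |].
  - set (d := dist O1 O2) in *.
    set (X := (fst O1 + r1 / d * (fst O1 - fst O2), snd O1 + r1 / d * (snd O1 - snd O2))).
    assert (HX1 : dist X O1 = r1).
    { apply dist_eq; [lra |].
      transitivity ((r1 / d) ^ 2 * d ^ 2); [rewrite Hsq; unfold X; simpl; ring |].
      field; lra. }
    assert (HX2 : dist X O2 = d + r1).
    { apply dist_eq; [lra |].
      transitivity ((1 + r1 / d) ^ 2 * d ^ 2); [rewrite Hsq; unfold X; simpl; ring |].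
      field; lra. }
    rewrite <- HX2. apply Hin. lra.
  - rewrite <- Hd in *.
    destruct (Rplus_sqr_eq_0 (fst O1 - fst O2) (snd O1 - snd O2)) as [E1 E2];
      [unfold Rsqr; lra |].
    set (X := (fst O1 + r1, snd O1)).
    assert (HX1 : dist X O1 = r1) by (apply dist_eq; unfold X; simpl; [lra | ring]).
    assert (HX2 : dist X O2 = r1).
    { apply dist_eq; unfold X; simpl; [lra |].
      replace (fst O1) with (fst O2) by lra. replace (snd O1) with (snd O2) by lra. ring. }
    specialize (Hin X). lra.
Qed.

(** * Circles and the sides of a triangle; the incenter *)

(** The radius to the point of contact is perpendicular to [PQ], so twice the area of [PQO] is base
    times height. Squaring removes the unknown orientation. *)
Lemma tangent_to_side_orient (O P Q : point) (r : R) :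
  0 < dist P Q -> tangent_to_side O r P Q -> orient P Q O ^ 2 = (r * dist P Q) ^ 2.
Proof.
  intros HPQ [T [[t [_ Ht]] HT]]. unfold on_circle in HT.
  destruct (proj2 (HT T) eq_refl) as [_ HTr].
  pose proof (dist_sqr P Q) as Hsq. pose proof (dist_sqr T O) as HsqT.
  rewrite HTr in HsqT.
  set (u1 := fst Q - fst P). set (u2 := snd Q - snd P).
  set (l := (u1 * (fst T - fst O) + u2 * (snd T - snd O)) / dist P Q ^ 2).
  assert (Hl : u1 * (fst T - fst O) + u2 * (snd T - snd O) = l * (u1 ^ 2 + u2 ^ 2)).
  { replace (u1 ^ 2 + u2 ^ 2) with (dist P Q ^ 2) by (rewrite Hsq; unfold u1, u2; ring).
    unfold l; field; lra. }
  (* The reflection of the point of contact in the foot of the perpendicular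
     from O is again on the line and on the circle. *)
  set (X := (fst T - 2 * l * u1, snd T - 2 * l * u2)).
  assert (EX : X = T).
  { apply HT. split.
    - exists (t - 2 * l). unfold X, u1, u2. rewrite Ht; simpl. f_equal; ring.
    - apply dist_eq; [rewrite <- HTr; apply dist_nonneg |].
      rewrite HsqT. unfold X; simpl fst; simpl snd.
      transitivity ((fst T - fst O) ^ 2 + (snd T - snd O) ^ 2
        - 4 * l * (u1 * (fst T - fst O) + u2 * (snd T - snd O) - l * (u1 ^ 2 + u2 ^ 2)));
        [ring | rewrite Hl; ring]. }
  assert (F1 : l * u1 = 0).
  { apply (f_equal fst) in EX. unfold X in EX; simpl in EX; lra. }
  assert (F2 : l * u2 = 0).
  { apply (f_equal snd) in EX. unfold X in EX; simpl in EX; lra. }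
  assert (Hperp : u1 * (fst T - fst O) + u2 * (snd T - snd O) = 0).
  { rewrite Hl. transitivity (l * u1 * u1 + l * u2 * u2); [ring | rewrite F1, F2; ring]. }
  assert (Horient : orient P Q O = u1 * (snd O - snd T) - u2 * (fst O - fst T)).
  { unfold orient, u1, u2. rewrite Ht; simpl. ring. }
  rewrite Horient, Rpow_mult_distr, HsqT, Hsq.
  (* Lagrange's identity; the inner product vanishes by [Hperp]. *)
  transitivity ((u1 ^ 2 + u2 ^ 2) * ((fst T - fst O) ^ 2 + (snd T - snd O) ^ 2)
    - (u1 * (fst T - fst O) + u2 * (snd T - snd O)) ^ 2); [ring |].
  rewrite Hperp. unfold u1, u2. ring.
Qed.

(** The point [X] reached from [O] by moving [r] perpendicularly towards the line [BC] still has a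
    nonnegative weight at [A]. The sign [e] of the orientation selects the direction. *)
Lemma disc_in_triangle_barycentric (A B C O : point) (r u v w : R) :
  0 <= r -> 0 < dist B C -> orient A B C <> 0 ->
  (forall X, in_disc O r X -> in_triangle A B C X) ->
  u + v + w = 1 ->
  O = (u * fst A + v * fst B + w * fst C, u * snd A + v * snd B + w * snd C) ->
  r * dist B C <= u * Rabs (orient A B C).
Proof.
  intros Hr Ha HD Hin Huvw HO.
  pose proof (dist_sqr B C) as Hsq.
  set (a := dist B C) in *.
  assert (He : exists e, e ^ 2 = 1 /\ Rabs (orient A B C) = e * orient A B C).
  { destruct (Rcase_abs (orient A B C)).
    - exists (-1). rewrite Rabs_left by easy. lra.
    - exists 1. rewrite Rabs_right by easy. lra. }
  destruct He as [e [He1 He2]].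
  set (X := (fst O + e * r / a * (snd C - snd B), snd O - e * r / a * (fst C - fst B))).
  destruct (Hin X) as (u' & v' & w' & Hu' & _ & _ & Hs' & HX).
  { unfold in_disc. apply Req_le, dist_eq; [easy |].
    transitivity (e ^ 2 * (r / a) ^ 2 * a ^ 2);
      [rewrite Hsq; unfold X; simpl; field; lra | rewrite He1; field; lra]. }
  assert (E1 : orient B C X = u' * orient A B C).
  { rewrite HX. unfold orient; simpl. replace u' with (1 - v' - w') by lra. ring. }
  assert (E2 : orient B C X = u * orient A B C - e * r * a).
  { transitivity (orient B C O - e * r / a * a ^ 2).
    - rewrite Hsq. unfold X, orient; simpl. field; lra.
    - replace (orient B C O) with (u * orient A B C); [field; lra |].
      rewrite HO. unfold orient; simpl. replace u with (1 - v - w) by lra. ring. }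
  assert (E3 : u * (e * orient A B C) - e ^ 2 * (r * a) = u' * (e * orient A B C)).
  { transitivity (e * (u * orient A B C - e * r * a)); [ring |].
    rewrite <- E2, E1. ring. }
  rewrite <- He2, He1 in E3.
  pose proof (Rabs_pos (orient A B C)). nra.
Qed.

(* With x, y, z the tangent lengths s - a, s - b, s - c, the barycentric weights
   of the incenter are the side lengths y + z, z + x, x + y. *)
Definition incenter (x y z : R) (A B C : point) : point :=
  (((y + z) * fst A + (z + x) * fst B + (x + y) * fst C) / (2 * (x + y + z)),
   ((y + z) * snd A + (z + x) * snd B + (x + y) * snd C) / (2 * (x + y + z))).

Lemma incenter_cyclic (x y z : R) (A B C : point) :
  incenter y z x B C A = incenter x y z A B C.
Proof.
  unfold incenter. replace (y + z + x) with (x + y + z) by ring.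
  f_equal; f_equal; ring.
Qed.

Lemma orient_cyclic (A B C : point) : orient B C A = orient A B C.
Proof. unfold orient; ring. Qed.

(** This is Pythagoras for [A], the incenter and a contact point of the incircle, at distance [x]
    from [A]. *)
Lemma incenter_vertex (A B C : point) (x y z r : R) :
  0 < x -> 0 < y -> 0 < z ->
  dist B C = y + z -> dist C A = z + x -> dist A B = x + y ->
  r ^ 2 * (x + y + z) = x * y * z ->
  (fst A - fst (incenter x y z A B C)) ^ 2 + (snd A - snd (incenter x y z A B C)) ^ 2
    = x ^ 2 + r ^ 2.
Proof.
  intros Hx Hy Hz Ha Hb Hc Hr.
  pose proof (dist_sqr B C) as HA. pose proof (dist_sqr C A) as HB.
  pose proof (dist_sqr A B) as HC. rewrite Ha in HA. rewrite Hb in HB. rewrite Hc in HC.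
  destruct A as [A1 A2], B as [B1 B2], C as [C1 C2]; unfold incenter; simpl fst in *; simpl snd in *.
  replace (r ^ 2) with (x * y * z / (x + y + z)) by (rewrite <- Hr; field; lra).
  (* For sides a, b, c and semiperimeter s, I - A = (b (B - A) + c (C - A)) / (2 s); its square is
     expanded by the law of cosines. *)
  transitivity (((z + x) * (x + y) * ((z + x) * (x + y) * 2
      + (z + x) ^ 2 + (x + y) ^ 2 - (y + z) ^ 2)) / (4 * (x + y + z) ^ 2)).
  2: field; lra.
  set (p1 := B1 - A1) in *. set (p2 := B2 - A2) in *.
  set (q1 := C1 - A1) in *. set (q2 := C2 - A2) in *.
  transitivity (((z + x) ^ 2 * (p1 ^ 2 + p2 ^ 2) + (x + y) ^ 2 * (q1 ^ 2 + q2 ^ 2)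
    + (z + x) * (x + y) * (2 * (p1 * q1 + p2 * q2))) / (4 * (x + y + z) ^ 2)).
  { unfold p1, p2, q1, q2; field; lra. }
  replace (2 * (p1 * q1 + p2 * q2)) with ((z + x) ^ 2 + (x + y) ^ 2 - (y + z) ^ 2)
    by (rewrite HA, HB, HC; unfold p1, p2, q1, q2; ring).
  replace (p1 ^ 2 + p2 ^ 2) with ((x + y) ^ 2) by (rewrite HC; unfold p1, p2; ring).
  replace (q1 ^ 2 + q2 ^ 2) with ((z + x) ^ 2) by (rewrite HB; unfold q1, q2; ring).
  field; lra.
Qed.

(** * The circles of the triad *)

(** Here [r] is the inradius and [r / x] is tan (A / 2). *)
Lemma triad_circle_center (A B C O : point) (rho x y z r : R) :
  0 < x -> 0 < y -> 0 < z -> 0 < r ->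
  dist B C = y + z -> dist C A = z + x -> dist A B = x + y ->
  r ^ 2 * (x + y + z) = x * y * z ->
  Rabs (orient A B C) = 2 * r * (x + y + z) ->
  triad_circle A B C O rho ->
  let I := incenter x y z A B C in
  rho = r * (1 - r / x) /\
  fst O = fst I + r / x * (fst A - fst I) /\ snd O = snd I + r / x * (snd A - snd I).
Proof.
  intros Hx Hy Hz Hr Ha Hb Hc Hrs HD (Hrho & Hin & HtB & HtC & T & _ & HT) I.
  assert (HM := externally_tangent_dist O (midpoint B C) rho (dist B C / 2) Hrho
    ltac:(lra) (ex_intro _ T HT)).
  destruct (Hin O) as (u & v & w & Hu & Hv & Hw & Huvw & HO).
  { unfold in_disc. apply Rle_trans with 0; [apply Req_le, dist_eq; [lra | ring] | lra]. }
  assert (HD0 : orient A B C <> 0) by (intros E; rewrite E, Rabs_R0 in HD; nra).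
  assert (Hub := disc_in_triangle_barycentric A B C O rho u v w
    ltac:(lra) ltac:(lra) HD0 Hin Huvw HO).
  apply tangent_to_side_orient in HtB; [| lra].
  apply tangent_to_side_orient in HtC; [| rewrite dist_sym; lra].
  rewrite (dist_sym A C), Hb in HtC. rewrite Hc in HtB. rewrite Ha, HD in Hub.
  assert (HD2 : orient A B C ^ 2 = (2 * r * (x + y + z)) ^ 2)
    by (rewrite <- HD; symmetry; apply pow2_abs).
  assert (Hrs0 : 0 < 2 * r * (x + y + z)) by nra.
  (* Tangency gives the weights only up to sign; they are nonnegative because [O] lies in the
     triangle. *)
  assert (Ew : w * (2 * r * (x + y + z)) = rho * (x + y)).
  { apply Rsqr_inj; [nra | nra |]. rewrite !Rsqr_pow2, <- HtB, Rpow_mult_distr, <- HD2, HO.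
    unfold orient; simpl. replace u with (1 - v - w) by lra. ring. }
  assert (Ev : v * (2 * r * (x + y + z)) = rho * (z + x)).
  { apply Rsqr_inj; [nra | nra |]. rewrite !Rsqr_pow2, <- HtC, Rpow_mult_distr, <- HD2, HO.
    unfold orient; simpl. replace u with (1 - v - w) by lra. ring. }
  set (t := 1 - rho / r).
  assert (Ht : rho = (1 - t) * r) by (unfold t; field; lra).
  (* Adding [Hub], [Ev] and [Ew] bounds [rho] by the inradius. *)
  assert (Ht0 : 0 <= t).
  { assert (rho * (x + y + z) <= r * (x + y + z)) by nra.
    assert (rho <= r) by nra.
    apply Rmult_le_reg_r with r; lra. }
  assert (Ew' : w = (1 - t) * (x + y) / (2 * (x + y + z))).
  { apply (Rmult_eq_reg_r (2 * r * (x + y + z))); [| nra]. rewrite Ew, Ht. field; lra. }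
  assert (Ev' : v = (1 - t) * (z + x) / (2 * (x + y + z))).
  { apply (Rmult_eq_reg_r (2 * r * (x + y + z))); [| nra]. rewrite Ev, Ht. field; lra. }
  assert (HO1 : fst O = fst I + t * (fst A - fst I)).
  { rewrite HO. unfold I, incenter; simpl. replace u with (1 - v - w) by lra.
    rewrite Ew', Ev'. field; lra. }
  assert (HO2 : snd O = snd I + t * (snd A - snd I)).
  { rewrite HO. unfold I, incenter; simpl. replace u with (1 - v - w) by lra.
    rewrite Ew', Ev'. field; lra. }
  enough (Htx : t * x = r).
  { assert (Et : t = r / x) by (rewrite <- Htx; field; lra).
    rewrite <- Et. repeat split; [rewrite Ht; ring | easy | easy]. }
  pose proof (dist_sqr O (midpoint B C)) as HMsq. rewrite HM, Ha, Ht in HMsq.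
  (* The other root of the quadratic equation for t is negative. *)
  assert (Hquad : t ^ 2 * x ^ 2 + t * (y + z) * (x + r) - y * z - r * (y + z) = 0).
  { pose proof (dist_sqr B C) as HA. pose proof (dist_sqr C A) as HB.
    pose proof (dist_sqr A B) as HC. rewrite Ha in HA. rewrite Hb in HB. rewrite Hc in HC.
    set (p1 := fst B - fst A). set (p2 := snd B - snd A).
    set (q1 := fst C - fst A). set (q2 := snd C - snd A).
    (* From the midpoint of [BC], the center [O] is (v - 1/2) (B - A) + (w - 1/2) (C - A). *)
    assert (Exp : (fst O - fst (midpoint B C)) ^ 2 + (snd O - snd (midpoint B C)) ^ 2
      = (v - 1 / 2) ^ 2 * (p1 ^ 2 + p2 ^ 2) + (w - 1 / 2) ^ 2 * (q1 ^ 2 + q2 ^ 2)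
        + (v - 1 / 2) * (w - 1 / 2) * (2 * (p1 * q1 + p2 * q2))).
    { rewrite HO. unfold midpoint, p1, p2, q1, q2; simpl.
      replace u with (1 - v - w) by lra. field. }
    replace (2 * (p1 * q1 + p2 * q2)) with ((z + x) ^ 2 + (x + y) ^ 2 - (y + z) ^ 2) in Exp
      by (rewrite HA, HB, HC; unfold p1, p2, q1, q2; ring).
    replace (p1 ^ 2 + p2 ^ 2) with ((x + y) ^ 2) in Exp
      by (rewrite HC; unfold p1, p2; ring).
    replace (q1 ^ 2 + q2 ^ 2) with ((z + x) ^ 2) in Exp
      by (rewrite HB; unfold q1, q2; ring).
    rewrite Exp, Ew', Ev' in HMsq.
    assert (Hr2 : r ^ 2 = x * y * z / (x + y + z)) by (rewrite <- Hrs; field; lra).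
    replace (((1 - t) * r + (y + z) / 2) ^ 2) with
      ((1 - t) ^ 2 * r ^ 2 + (1 - t) * r * (y + z) + (y + z) ^ 2 / 4) in HMsq by field.
    rewrite Hr2 in HMsq. apply Rminus_diag_eq in HMsq.
    rewrite <- Ropp_0, <- HMsq. field; lra. }
  (* Times [r], and modulo [Hrs], the quadratic splits into linear factors. *)
  assert (Hfac : (t * x - r) * (t * x * r + y * z + r * (y + z)) = 0).
  { transitivity (r * (t ^ 2 * x ^ 2 + t * (y + z) * (x + r) - y * z - r * (y + z))
      + t * (x * y * z - r ^ 2 * (x + y + z))); [ring |].
    rewrite Hquad, Hrs. ring. }
  apply Rmult_integral in Hfac. destruct Hfac as [Hfac | Hfac]; [lra |].
  assert (0 <= t * x * r) by (apply Rmult_le_pos; [apply Rmult_le_pos |]; lra).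
  assert (0 < y * z) by (apply Rmult_lt_0_compat; lra).
  assert (0 < r * (y + z)) by (apply Rmult_lt_0_compat; lra).
  lra.
Qed.

(* (A - I).(B - I) = r^2 - xy, because |A - I|^2 = x^2 + r^2, |B - I|^2 = y^2 + r^2
   and |A - B| = x + y. *)
Lemma triad_common_tangent (A B I Oa Ob : point) (x y r : R) :
  0 < x -> 0 < y ->
  (fst A - fst I) ^ 2 + (snd A - snd I) ^ 2 = x ^ 2 + r ^ 2 ->
  (fst B - fst I) ^ 2 + (snd B - snd I) ^ 2 = y ^ 2 + r ^ 2 ->
  dist A B = x + y ->
  fst Oa = fst I + r / x * (fst A - fst I) -> snd Oa = snd I + r / x * (snd A - snd I) ->
  fst Ob = fst I + r / y * (fst B - fst I) -> snd Ob = snd I + r / y * (snd B - snd I) ->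
  (fst Oa - fst Ob) ^ 2 + (snd Oa - snd Ob) ^ 2
    - (r * (1 - r / x) - r * (1 - r / y)) ^ 2 = 4 * r ^ 2.
Proof.
  intros Hx Hy HA HB HAB H1 H2 H3 H4. rewrite H1, H2, H3, H4.
  pose proof (dist_sqr A B) as Hsq. rewrite HAB in Hsq.
  set (p1 := fst A - fst I) in *. set (p2 := snd A - snd I) in *.
  set (q1 := fst B - fst I) in *. set (q2 := snd B - snd I) in *.
  replace (fst A - fst B) with (p1 - q1) in Hsq by (unfold p1, q1; ring).
  replace (snd A - snd B) with (p2 - q2) in Hsq by (unfold p2, q2; ring).
  assert (Hpq : p1 * q1 + p2 * q2 = r ^ 2 - x * y) by nra.
  transitivity ((r / x) ^ 2 * (p1 ^ 2 + p2 ^ 2) + (r / y) ^ 2 * (q1 ^ 2 + q2 ^ 2)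
    - 2 * (r / x) * (r / y) * (p1 * q1 + p2 * q2) - (r * (r / x - r / y)) ^ 2); [ring |].
  rewrite HA, HB, Hpq. field; lra.
Qed.

(** * Equilateral triangles in Minkowski space *)

(** The difference [d] of the two null points and [w], six times the vector from the centroid to
    their midpoint, are both orthogonal to the edges [u] and [v], hence parallel. They are also
    orthogonal to each other, and the normal of a spacelike plane is not null, so one of them
    vanishes. *)
Lemma equidistant_null_points
  (a1 a2 a3 b1 b2 b3 c1 c2 c3 q1 q2 q3 s1 s2 s3 m : R) :
  0 < m ->
  (a1 - b1) ^ 2 + (a2 - b2) ^ 2 - (a3 - b3) ^ 2 = m ->
  (b1 - c1) ^ 2 + (b2 - c2) ^ 2 - (b3 - c3) ^ 2 = m ->
  (c1 - a1) ^ 2 + (c2 - a2) ^ 2 - (c3 - a3) ^ 2 = m ->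
  (a1 - q1) ^ 2 + (a2 - q2) ^ 2 = (q3 - a3) ^ 2 ->
  (b1 - q1) ^ 2 + (b2 - q2) ^ 2 = (q3 - b3) ^ 2 ->
  (c1 - q1) ^ 2 + (c2 - q2) ^ 2 = (q3 - c3) ^ 2 ->
  (a1 - s1) ^ 2 + (a2 - s2) ^ 2 = (s3 - a3) ^ 2 ->
  (b1 - s1) ^ 2 + (b2 - s2) ^ 2 = (s3 - b3) ^ 2 ->
  (c1 - s1) ^ 2 + (c2 - s2) ^ 2 = (s3 - c3) ^ 2 ->
  q3 <> s3 ->
  3 * (q3 + s3) = 2 * (a3 + b3 + c3).
Proof.
  intros Hm Hab Hbc Hca Qa Qb Qc Sa Sb Sc Hne.
  set (u1 := b1 - a1). set (u2 := b2 - a2). set (p := b3 - a3).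
  set (v1 := c1 - a1). set (v2 := c2 - a2). set (q := c3 - a3).
  set (d1 := q1 - s1). set (d2 := q2 - s2). set (d := q3 - s3).
  set (w1 := 3 * (q1 + s1) - 2 * (a1 + b1 + c1)).
  set (w2 := 3 * (q2 + s2) - 2 * (a2 + b2 + c2)).
  set (w := 3 * (q3 + s3) - 2 * (a3 + b3 + c3)).
  assert (Euu : u1 ^ 2 + u2 ^ 2 = m + p ^ 2) by (unfold u1, u2, p; lra).
  assert (Evv : v1 ^ 2 + v2 ^ 2 = m + q ^ 2) by (unfold v1, v2, q; lra).
  assert (Euv : 2 * (u1 * v1 + u2 * v2) = m + 2 * p * q)
    by (unfold u1, u2, p, v1, v2, q; lra).
  assert (Eud : u1 * d1 + u2 * d2 = p * d) by (unfold u1, u2, p, d1, d2, d; lra).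
  assert (Evd : v1 * d1 + v2 * d2 = q * d) by (unfold v1, v2, q, d1, d2, d; lra).
  assert (Euw : u1 * w1 + u2 * w2 = p * w) by (unfold u1, u2, p, w1, w2, w; lra).
  assert (Evw : v1 * w1 + v2 * w2 = q * w) by (unfold v1, v2, q, w1, w2, w; lra).
  assert (Edw : d1 * w1 + d2 * w2 = d * w) by (unfold d1, d2, d, w1, w2, w; lra).
  assert (Hd : d <> 0) by (unfold d; lra).
  enough (Hw : w = 0) by (unfold w in Hw; lra).
  clearbody u1 u2 p v1 v2 q d1 d2 d w1 w2 w.
  clear - Hm Euu Evv Euv Eud Evd Euw Evw Edw Hd.
  set (D := u1 * v2 - u2 * v1).
  (* Cramer's rule: a vector orthogonal to u and v is determined by its third
     coordinate. *)
  assert (D1 : D * d1 = d * (p * v2 - q * u2)).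
  { transitivity (v2 * (u1 * d1 + u2 * d2) - u2 * (v1 * d1 + v2 * d2));
      [unfold D; ring | rewrite Eud, Evd; ring]. }
  assert (D2 : D * d2 = d * (u1 * q - v1 * p)).
  { transitivity (u1 * (v1 * d1 + v2 * d2) - v1 * (u1 * d1 + u2 * d2));
      [unfold D; ring | rewrite Eud, Evd; ring]. }
  assert (W1 : D * w1 = w * (p * v2 - q * u2)).
  { transitivity (v2 * (u1 * w1 + u2 * w2) - u2 * (v1 * w1 + v2 * w2));
      [unfold D; ring | rewrite Euw, Evw; ring]. }
  assert (W2 : D * w2 = w * (u1 * q - v1 * p)).
  { transitivity (u1 * (v1 * w1 + v2 * w2) - v1 * (u1 * w1 + u2 * w2));
      [unfold D; ring | rewrite Euw, Evw; ring]. }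
  assert (Key : d * w * D ^ 2
    = d * w * (q ^ 2 * (u1 ^ 2 + u2 ^ 2) + p ^ 2 * (v1 ^ 2 + v2 ^ 2)
               - p * q * (2 * (u1 * v1 + u2 * v2)))).
  { rewrite <- Edw at 1.
    transitivity ((D * d1) * (D * w1) + (D * d2) * (D * w2)); [ring |].
    rewrite D1, D2, W1, W2. ring. }
  assert (ED : D ^ 2 = (m + p ^ 2) * (m + q ^ 2) - (m + 2 * p * q) ^ 2 / 4).
  { rewrite <- Euu, <- Evv, <- Euv. unfold D. field. }
  rewrite ED, Euu, Evv, Euv in Key.
  (* The factor is the Minkowski Gram determinant of [u] and [v], namely m^2 - (m / 2)^2. *)
  assert (Key' : d * w * (3 * m ^ 2 / 4) = 0) by lra.
  apply Rmult_integral in Key'. destruct Key' as [Key' | Key']; [| nra].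
  apply Rmult_integral in Key'. tauto.
Qed.

(** * Tangent lengths and the conclusion *)

(** The triangle inequality makes the tangent lengths nonnegative, and Heron's formula makes them
    nonzero. The inradius is the area over the semiperimeter. *)
Lemma tangent_lengths (A B C : point) :
  orient A B C <> 0 ->
  exists x y z r, 0 < x /\ 0 < y /\ 0 < z /\ 0 < r /\
    dist B C = y + z /\ dist C A = z + x /\ dist A B = x + y /\
    r ^ 2 * (x + y + z) = x * y * z /\
    Rabs (orient A B C) = 2 * r * (x + y + z).
Proof.
  intros HD.
  pose proof (dist_nonneg B C) as Ha. pose proof (dist_nonneg C A) as Hb.
  pose proof (dist_nonneg A B) as Hc.
  assert (Tc := dist_triangle A B C). rewrite (dist_sym A C), (dist_sym C B) in Tc.
  assert (Ta := dist_triangle B C A). rewrite (dist_sym B A), (dist_sym A C) in Ta.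
  assert (Tb := dist_triangle C A B). rewrite (dist_sym C B), (dist_sym B A) in Tb.
  pose proof (dist_sqr B C) as HA. pose proof (dist_sqr C A) as HB.
  pose proof (dist_sqr A B) as HC.
  set (a := dist B C) in *. set (b := dist C A) in *. set (c := dist A B) in *.
  set (x := (b + c - a) / 2). set (y := (c + a - b) / 2). set (z := (a + b - c) / 2).
  assert (Heron : orient A B C ^ 2 = 4 * ((x + y + z) * (x * y * z))).
  { transitivity ((4 * c ^ 2 * b ^ 2 - (b ^ 2 + c ^ 2 - a ^ 2) ^ 2) / 4).
    - rewrite HA, HB, HC. unfold orient. field.
    - unfold x, y, z. field. }
  assert (Hpos : 0 < orient A B C ^ 2) by nra.
  assert (Hx : 0 <= x) by (unfold x; lra).
  assert (Hy : 0 <= y) by (unfold y; lra).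
  assert (Hz : 0 <= z) by (unfold z; lra).
  assert (Hx' : 0 < x).
  { destruct Hx as [| E]; [easy |]. rewrite Heron, <- E in Hpos; lra. }
  assert (Hy' : 0 < y).
  { destruct Hy as [| E]; [easy |]. rewrite Heron, <- E in Hpos; lra. }
  assert (Hz' : 0 < z).
  { destruct Hz as [| E]; [easy |]. rewrite Heron, <- E in Hpos; lra. }
  exists x, y, z, (Rabs (orient A B C) / (2 * (x + y + z))).
  repeat split; try easy.
  - apply Rdiv_lt_0_compat; [apply Rabs_pos_lt; easy | lra].
  - unfold y, z; field.
  - unfold x, z; field.
  - unfold x, y; field.
  - transitivity (Rabs (orient A B C) ^ 2 / (4 * (x + y + z))); [field; lra |].
    rewrite pow2_abs, Heron. field; lra.
  - field; lra.
Qed.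

Theorem corollary6p3 :
  forall (A B C Oa Ob Oc Oi Oo : point) (rho_a rho_b rho_c rho_i rho_o : R),
    acute_triangle A B C ->
    triad_circle A B C Oa rho_a ->
    triad_circle B C A Ob rho_b ->
    triad_circle C A B Oc rho_c ->
    inner_apollonius Oa rho_a Ob rho_b Oc rho_c Oi rho_i ->
    outer_apollonius Oa rho_a Ob rho_b Oc rho_c Oo rho_o ->
    3 * rho_o = 2 * (rho_a + rho_b + rho_c) + 3 * rho_i.
Proof.
  intros A B C Oa Ob Oc Oi Oo rho_a rho_b rho_c rho_i rho_o [HD _] Ta Tb Tc
    (Hi & Ia & Ib & Ic) (Ho & Ea & Eb & Ec).
  assert (Pa : 0 < rho_a) by apply Ta.
  assert (Pb : 0 < rho_b) by apply Tb.
  assert (Pc : 0 < rho_c) by apply Tc.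
  apply externally_tangent_dist in Ia, Ib, Ic; try easy.
  apply internally_tangent_dist in Ea, Eb, Ec; try easy.
  destruct (tangent_lengths A B C HD)
    as (x & y & z & r & Hx & Hy & Hz & Hr & Ha & Hb & Hc & Hrs & HO).
  assert (HOb : Rabs (orient B C A) = 2 * r * (y + z + x))
    by (rewrite orient_cyclic, HO; ring).
  assert (HOc : Rabs (orient C A B) = 2 * r * (z + x + y))
    by (rewrite orient_cyclic, HOb; ring).
  assert (Hrb : r ^ 2 * (y + z + x) = y * z * x) by lra.
  assert (Hrc : r ^ 2 * (z + x + y) = z * x * y) by lra.
  destruct (triad_circle_center A B C Oa rho_a x y z r) as (Ra & Xa & Ya); try easy.
  destruct (triad_circle_center B C A Ob rho_b y z x r) as (Rb & Xb & Yb); try easy.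
  destruct (triad_circle_center C A B Oc rho_c z x y r) as (Rc & Xc & Yc); try easy.
  assert (Va := incenter_vertex A B C x y z r Hx Hy Hz Ha Hb Hc Hrs).
  assert (Vb := incenter_vertex B C A y z x r Hy Hz Hx Hb Hc Ha Hrb).
  assert (Vc := incenter_vertex C A B z x y r Hz Hx Hy Hc Ha Hb Hrc).
  (* The three cyclic relabellings are brought to one common incenter. *)
  rewrite incenter_cyclic in Vb, Xb, Yb.
  rewrite incenter_cyclic, incenter_cyclic in Vc, Xc, Yc.
  assert (Gab := triad_common_tangent A B _ Oa Ob x y r Hx Hy Va Vb Hc Xa Ya Xb Yb).
  assert (Gbc := triad_common_tangent B C _ Ob Oc y z r Hy Hz Vb Vc Ha Xb Yb Xc Yc).
  assert (Gca := triad_common_tangent C A _ Oc Oa z x r Hz Hx Vc Va Hb Xc Yc Xa Ya).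
  rewrite <- Ra, <- Rb in Gab. rewrite <- Rb, <- Rc in Gbc. rewrite <- Rc, <- Ra in Gca.
  pose proof (dist_sqr Oa Oo) as Na. pose proof (dist_sqr Ob Oo) as Nb.
  pose proof (dist_sqr Oc Oo) as Nc. pose proof (dist_sqr Oa Oi) as Ma.
  pose proof (dist_sqr Ob Oi) as Mb. pose proof (dist_sqr Oc Oi) as Mc.
  rewrite Ea in Na; rewrite Eb in Nb; rewrite Ec in Nc;
    rewrite Ia in Ma; rewrite Ib in Mb; rewrite Ic in Mc.
  pose proof (pow_lt r 2 Hr).
  (* The sign of [- rho_i] turns external tangency into the null condition, and it separates the two
     null points since both radii are positive. *)
  enough (3 * (rho_o + - rho_i) = 2 * (rho_a + rho_b + rho_c)) by lra.
  apply (equidistant_null_points (fst Oa) (snd Oa) rho_a (fst Ob) (snd Ob) rho_b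
    (fst Oc) (snd Oc) rho_c (fst Oo) (snd Oo) rho_o (fst Oi) (snd Oi) (- rho_i)
    (4 * r ^ 2)); lra.
Qed.
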